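(* Let $f\ge1$ be an integer, let $G=(V,E)$ be a connected graph with unique node identifiers, and let $S$ be a $(2f+2,2f+1)$-ruling set of $G$ where each node knows whether it belongs to $S$. There exists a deterministic $\mathsf{Congest}$ algorithm that partitions $V$ into disjoint groups $Q_1,\dots,Q_K$, each of size between $f+1$ and $3f+1$, and provides a set of $(2,4f)$-shortcuts for these groups. The algorithm completes in $\Theta(f)$ rounds.
   Context: An $(\alpha,\beta)$-ruling set is a set $S\subseteq V$ such that every two distinct nodes of $S$ are at distance at least $\alpha$, and every node is within distance at most $\beta$ of $S$. Given a partition of $V$ into disjoint sets $Q_1,\dots,Q_K$, a collection of subgraphs $H_1,\dots,H_K\subseteq G$ is a set of $(c,d)$-shortcuts if (1) each subgraph $G[Q_i]\cup H_i$ is connected, (2) each $G[Q_i]\cup H_i$ has diameter at most $d$, and (3) each edge $e\in E$ is contained in at most $c$ of the subgraphs $G[Q_i]\cup H_i$. In the $\mathsf{Congest}$ model, nodes communicate in synchronous rounds by exchanging $O(\log n)$-bit messages along edges, where $n=|V|$. At the end of the algorithm every node knows its group and, for its incident edges, which shortcut subgraphs $H_i$ contain them.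
   Formalization: The formal theorem assumes |V| ≥ f+1 (for a nonempty graph with fewer nodes no group of size f+1 exists, e.g. one node, S = V, f = 1) and makes explicit the usual Congest convention that identifiers are below n^k for some constant k. *)

(* Defs.v *)
From HB Require Import structures.
From mathcomp Require Import all_boot all_order.

Set Implicit Arguments.
Unset Strict Implicit.
Unset Printing Implicit Defensive.

Record sgraph := SGraph {
  vertex :> finType;
  edge : rel vertex;
  edge_sym : symmetric edge;
  edge_irr : irreflexive edge
}.

Definition connected_graph (G : sgraph) : Prop :=
  forall u v : G, connect (@edge G) u v.

(* dist_le e u v k: the e-distance from u to v is at most k;
   dist_ge e u v k: it is at least k.
   The distance is the least length of a walk, and infinite if there is none. *)
Definition dist_le (T : eqType) (e : rel T) (u v : T) (k : nat) : Prop :=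
  exists p : seq T, [/\ path e u p, last u p = v & size p <= k].

Definition dist_ge (T : eqType) (e : rel T) (u v : T) (k : nat) : Prop :=
  forall p : seq T, path e u p -> last u p = v -> k <= size p.

Definition ruling_set (G : sgraph) (alpha beta : nat) (S : {set G}) : Prop :=
  (forall u v : G, u \in S -> v \in S -> u != v ->
     dist_ge (@edge G) u v alpha) /\
  (forall u : G, exists2 v : G, v \in S & dist_le (@edge G) u v beta).

Record subgraph (G : sgraph) := Subgraph {
  sub_vertex : {set G};
  sub_edge : rel G;
  sub_edge_sym : symmetric sub_edge;
  sub_edgeP : forall u v, sub_edge u v -> (u \in sub_vertex) && edge u v
}.

Section SubgraphOps.
Variable G : sgraph.

Definition induced_edge (Q : {set G}) : rel G :=
  [rel u v | [&& u \in Q, v \in Q & edge u v]].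

Lemma induced_edge_sym (Q : {set G}) : symmetric (induced_edge Q).
Proof. by move=> u v; rewrite /induced_edge /= edge_sym andbCA. Qed.

Lemma induced_edgeP (Q : {set G}) (u v : G) :
  induced_edge Q u v -> (u \in Q) && edge u v.
Proof. by case/and3P=> -> _ ->. Qed.

Definition induced (Q : {set G}) : subgraph G :=
  Subgraph (induced_edge_sym Q) (@induced_edgeP Q).

Variables H1 H2 : subgraph G.

Definition union_edge : rel G :=
  [rel u v | sub_edge H1 u v || sub_edge H2 u v].

Lemma union_edge_sym : symmetric union_edge.
Proof.
by move=> u v; rewrite /union_edge /= (@sub_edge_sym G H1) (@sub_edge_sym G H2).
Qed.

Lemma union_edgeP (u v : G) :
  union_edge u v -> (u \in sub_vertex H1 :|: sub_vertex H2) && edge u v.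
Proof.
by rewrite in_setU; case/orP=> /sub_edgeP/andP[-> ->]; rewrite ?orbT.
Qed.

Definition sub_union : subgraph G := Subgraph union_edge_sym union_edgeP.

End SubgraphOps.

Definition sub_connected (G : sgraph) (H : subgraph G) : Prop :=
  {in sub_vertex H &, forall u v, connect (sub_edge H) u v}.

Definition sub_diameter_le (G : sgraph) (H : subgraph G) (d : nat) : Prop :=
  {in sub_vertex H &, forall u v, dist_le (sub_edge H) u v d}.

Definition is_partition (T : finType) (K : nat) (Q : 'I_K -> {set T}) :
    Prop :=
  [/\ forall i, Q i != set0,
      forall i j, i != j -> [disjoint Q i & Q j]
    & \bigcup_i Q i = [set: T]].

Definition shortcuts (G : sgraph) (K : nat) (Q : 'I_K -> {set G})
    (H : 'I_K -> subgraph G) (c d : nat) : Prop :=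
  let GH i := sub_union (induced (Q i)) (H i) in
  [/\ forall i, sub_connected (GH i),
      forall i, sub_diameter_le (GH i) d
    & forall u v : G, edge u v -> #|[set i | sub_edge (GH i) u v]| <= c].

Definition message := seq bool.

(* A deterministic algorithm run by every node, with local inputs in I and
   local outputs in O.  [send s p] is the message sent through port p by a node
   in state s ([None] if the node stays silent on p); [step s m] is the next
   state, where m lists, port by port, what was received; a node halts as soon
   as [decide] returns its output. *)
Record algorithm (I O : Type) := Algorithm {
  state : Type;
  init : I -> state;
  send : state -> nat -> option message;
  step : state -> seq (option message) -> state;
  decide : state -> option O
}.

(* [ports v] lists the neighbours of v in an arbitrary order, unrelated to the
   identifiers and to the orders chosen at the other nodes; the neighbour behind
   port p of v is the p-th item of [ports v]. *)
Definition port_numbering (G : sgraph) (ports : G -> seq G) : Prop :=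
  forall v : G, uniq (ports v) /\ ports v =i [pred u | edge v u].

Section Execution.
Variables (I O : Type) (A : algorithm I O).
Variables (G : sgraph) (ports : G -> seq G) (x : G -> I).

Definition sent (s : G -> state A) (u : G) (p : nat) : option message :=
  if decide (s u) is Some _ then None else send (s u) p.

Definition inbox (s : G -> state A) (v : G) : seq (option message) :=
  [seq sent s u (index v (ports u)) | u <- ports v].

Fixpoint exec (r : nat) : G -> state A :=
  if r is r'.+1 then
    let s := exec r' in
    fun v => if decide (s v) is Some _ then s v else step (s v) (inbox s v)
  else fun v => init A (x v).

Definition output (r : nat) (v : G) : option O := decide (exec r v).

Definition all_halted (r : nat) : Prop := forall v : G, output r v <> None.

Definition completes_in (r : nat) : Prop :=
  all_halted r /\ forall r', r' < r -> ~ all_halted r'.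

Definition bandwidth_le (b : nat) : Prop :=
  forall (r : nat) (v : G) (p : nat) (m : message),
    p < size (ports v) -> sent (exec r) v p = Some m -> size m <= b.

End Execution.

Record local_input := LocalInput {
  in_f : nat;
  in_id : nat;
  in_ruling : bool;
  in_degree : nat
}.

(* Groups are named by numbers: [out_group] names the group of the node, and
   [out_shortcuts p] lists the names of the groups whose shortcut subgraph
   contains the edge behind port p. *)
Record local_output := LocalOutput {
  out_group : nat;
  out_shortcuts : nat -> seq nat
}.

Definition inputs (f : nat) (G : sgraph) (id : G -> nat) (S : {set G})
    (ports : G -> seq G) (v : G) : local_input :=
  LocalInput f (id v) (v \in S) (size (ports v)).

Definition outputs_encode (G : sgraph) (ports : G -> seq G)
    (out : G -> option local_output) (K : nat) (Q : 'I_K -> {set G})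
    (H : 'I_K -> subgraph G) (name : 'I_K -> nat) : Prop :=
  injective name /\
  forall v : G, exists o : local_output,
    [/\ out v = Some o,
        forall i, v \in Q i -> out_group o = name i
      & forall u, edge v u -> forall a : nat,
          a \in out_shortcuts o (index u (ports v)) <->
          exists2 i, a = name i & sub_edge (H i) v u].

(* Main.v *)
Require Import Defs.
From HB Require Import structures.
From mathcomp Require Import all_boot all_order zify.

(** Every node joins the tree of a nearest node of S, whose closeness
    2f + 2 - dist(., S) spreads in 2f + 2 rounds.  Going up the trees, a node
    collects the pending parts of its children, each of at most f nodes, packs
    them greedily into groups of f + 1 to 2f nodes, and adds itself to what is
    left: this is a group if it has f + 1 nodes, and is passed on to the parent
    otherwise.  A part left at a root joins a group that touches it, which exists
    since otherwise the whole tree has at most f nodes and, the roots being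
    2f + 2 apart, is all of G.  Groups thus have at most 3f nodes, and each group
    lies within distance 2f - 1 of the node that formed it, along edges having
    an end in the group.  So the edges with an end in a group can serve as its
    shortcut: they give diameter at most 4f, and an edge touches at most two
    groups.

    Nodes recompute all their messages from the last ones received, and the
    messages become stationary after about 3(2f + 2) rounds: first the
    closeness, then the sizes going up, then the group names going down. *)

Set Implicit Arguments.
Unset Strict Implicit.
Unset Printing Implicit Defensive.

(** * Walks and bounds on distances *)

Section Walks.
Variables (T : eqType) (e : rel T).
Implicit Types u v w : T.

Lemma dist_le_refl u : dist_le e u u 0.
Proof. by exists [::]. Qed.

Lemma dist_le_edge u v : e u v -> dist_le e u v 1.
Proof. by move=> euv; exists [:: v]; rewrite /= euv. Qed.

Lemma dist_le_trans u v w m n :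
  dist_le e u v m -> dist_le e v w n -> dist_le e u w (m + n).
Proof.
move=> [p [p1 p2 p3]] [q [q1 q2 q3]]; exists (p ++ q).
by rewrite cat_path last_cat size_cat p1 p2 q1 q2 leq_add.
Qed.

Lemma dist_le_weaken u v m n : m <= n -> dist_le e u v m -> dist_le e u v n.
Proof. by move=> mn [p [? ? ps]]; exists p; split=> //; apply: leq_trans mn. Qed.

Lemma dist_le_sym u v m : symmetric e -> dist_le e u v m -> dist_le e v u m.
Proof.
move=> esym [p [p1 <- p3]]; exists (rev (belast u p)).
rewrite size_rev size_belast; split=> //.
- by rewrite (eq_path (e' := fun x => e^~ x)) ?rev_path // => x y; rewrite esym.
- by case: (p) => //= a s; rewrite rev_cons last_rcons.
Qed.

End Walks.

Lemma dist_le_connect (V : finType) (r : rel V) (u v : V) m :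
  dist_le r u v m -> connect r u v.
Proof. by case=> p [pp pl _]; apply/connectP; exists p. Qed.

Lemma bigmax_gt0_exists (I : finType) (P : pred I) (F : I -> nat) :
  0 < \max_(i | P i) F i -> exists2 i, P i & F i = \max_(i | P i) F i.
Proof.
move=> max_gt0; have [|P0] := posnP #|P|; last first.
  by have [i Pi ->] := eq_bigmax_cond F P0; exists i.
move/card0_eq => P0; move: max_gt0; rewrite big_pred0 //.
Qed.

(* The edges of the shortcut subgraph of a group Q; they include those of G[Q]. *)
Definition touching (G : sgraph) (Q : {set G}) : rel G :=
  [rel u v | edge u v && ((u \in Q) || (v \in Q))].

Lemma touching_sym (G : sgraph) (Q : {set G}) : symmetric (touching Q).
Proof. by move=> u v; rewrite /touching /= edge_sym orbC. Qed.

(** * The groups of a forest *)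

Section Forest.
Variables (G : sgraph) (f : nat) (S : {set G}) (id : G -> nat).
(* c v = 2f + 2 - dist(v, S); pa v is the parent of v, itself if v is a root;
   lab w is the number of the bin of w among those of its parent, and the bins
   numbered below jE v form groups; the others, of total size acc v, stay with
   v; cand v is 1 + id x if a group (id x, 0) is reachable below v, else 0;
   og v is the name of the group of v. *)
Variables (c : G -> nat) (pa : G -> G) (acc jE lab cand : G -> nat).
Variable og : G -> nat * nat.

Let K := 2 * f + 2.
Let full v := acc v == f.
Let sz v := if full v then 0 else (acc v).+1.
Let child v w := (w \notin S) && (pa w == v).

Hypothesis f_gt0 : 0 < f.
Hypothesis cardG : f < #|G|.
Hypothesis Gconn : connected_graph G.
Hypothesis id_inj : injective id.
Hypothesis S_sep : forall u v : G, u \in S -> v \in S -> u != v ->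
  dist_ge (@edge G) u v (2 * f + 2).
Hypothesis c_le : forall v, c v <= K.
Hypothesis c_gt0 : forall v, 0 < c v.
Hypothesis c_root : forall v, v \in S -> c v = K.
Hypothesis c_nbr : forall u v : G, edge u v -> c u <= (c v).+1.
Hypothesis pa_root : forall v, v \in S -> pa v = v.
Hypothesis pa_edge : forall v, v \notin S -> edge v (pa v).
Hypothesis c_pa : forall v, v \notin S -> c (pa v) = (c v).+1.
Hypothesis acc_le : forall v, acc v <= f.
Hypothesis accE : forall v,
  acc v = \sum_(w | child v w && (jE v <= lab w)) sz w.
Hypothesis binP : forall v j, j < jE v ->
  f < \sum_(w | child v w && (lab w == j)) sz w <= 2 * f.
Hypothesis cand_own : forall v, full v || (0 < jE v) -> cand v = (id v).+1.
Hypothesis cand_desc : forall v, ~~ full v -> jE v = 0 ->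
  cand v = \max_(w | child v w) cand w.
Hypothesis ogE : forall v, og v =
  if full v then (id v, jE v) else if v \in S then ((cand v).-1, 0)
  else if lab v < jE (pa v) then (id (pa v), lab v) else og (pa v).

(** A node stays if its part forms a group, is left at a root, or is packed in a closed bin of the
    parent; otherwise [nx] follows the part into that of the parent. [W v] counts the nodes whose
    [nx] chain meets [v], and the chain of [v] ends at [top v]. *)
Let stay v := [|| full v, v \in S | lab v < jE (pa v)].
Let nx v := if stay v then v else pa v.
Let W v := (acc v).+1.
Let top v := iter K nx v.

Lemma og_nx v : og (nx v) = og v.
Proof.
rewrite /nx; case: ifP => //; rewrite /stay [in X in _ -> _ = X]ogE.
by case: (full v) => //=; case: (v \in S) => //= ->.
Qed.

Lemma nx_stay v : stay v -> nx v = v.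
Proof. by rewrite /nx => ->. Qed.

Lemma nx_move v : ~~ stay v -> v \notin S /\ nx v = pa v.
Proof.
move=> ns; rewrite /nx (negPf ns); split=> //.
by move: ns; rewrite /stay !negb_or => /and3P[].
Qed.

Lemma iter_nx_stay v i : stay v -> iter i nx v = v.
Proof. by move=> sv; elim: i => //= i ->; apply: nx_stay. Qed.

Lemma og_iter v i : og (iter i nx v) = og v.
Proof. by elim: i => //= i IH; rewrite og_nx. Qed.

Lemma W_split v : W v = 1 + \sum_(w | ~~ stay w && (pa w == v)) W w.
Proof.
rewrite /W accE add1n; congr _.+1.
rewrite big_mkcond [RHS]big_mkcond; apply: eq_bigr => w _.
rewrite /child /stay /sz !negb_or -leqNgt.
case: (w \in S) => /=; rewrite ?andbF //.
case: (full w) => //=; first by case: ifP.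
by rewrite andbC; case: eqP => [->|]; rewrite ?andbT ?andbF.
Qed.

Lemma W_pa v : ~~ stay v -> W v < W (pa v).
Proof.
by move=> sv; rewrite (W_split (pa v)) add1n ltnS (bigD1 v) ?sv ?eqxx //= leq_addr.
Qed.

(** Sum [W_split] over [Q]: the weights of the nodes that move on occur on both sides and cancel,
    since [nx] neither leaves nor enters [Q]. *)
Lemma class_card (Q : {set G}) :
  (forall v, (nx v \in Q) = (v \in Q)) ->
  #|Q| = \sum_(v in Q | stay v) W v.
Proof.
move=> Qnx; have: \sum_(v in Q) W v = \sum_(v in Q) W v by [].
rewrite {2}(bigID stay) /= (eq_bigr _ (fun v _ => W_split v)) big_split /=.
rewrite sum1_card => H.
rewrite [X in _ = _ + X](partition_big pa (mem Q)) /= in H; last first.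
  by move=> v /andP[vQ nsv]; have := Qnx v; rewrite /nx (negPf nsv) vQ.
apply: (@addIn _ _ _ (etrans H _)); congr (_ + _).
apply: eq_bigr => v vQ; apply: eq_bigl => w.
case: (boolP (stay w)) => [|nsw]; rewrite ?andbF //= andbT.
case: eqP => [pav|]; rewrite ?andbF // andbT.
by have := Qnx w; rewrite /nx (negPf nsw) pav => <-.
Qed.

Lemma stay_top v : stay (top v).
Proof.
(* Each move raises [c], positive at the start, so [K] moves would bring it above [K]. *)
have H i : stay (iter i nx v) || (i < c (iter i nx v)).
  elim: i => [|i IH]; first by rewrite c_gt0 orbT.
  rewrite iterS; case: (boolP (stay _)) IH => [s _|ns /=]; first by rewrite nx_stay ?s.
  have [nS ->] := nx_move ns; move=> lt_i.
  by rewrite c_pa // ltnS lt_i orbT.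
by have /orP[//|] := H K; rewrite ltnNge c_le.
Qed.

Lemma top_unique x s i : stay s -> iter i nx x = s -> top x = s.
Proof.
move=> st ix; rewrite -(iter_nx_stay i (stay_top x)) /top -iterD addnC iterD ix.
exact: iter_nx_stay.
Qed.

(** Each move raises [W], so the gain in weight pays for the length of the chain. *)
Lemma chain_dist (Q : {set G}) u i :
  (forall v, (nx v \in Q) = (v \in Q)) -> u \in Q ->
  exists n, dist_le (touching Q) u (iter i nx u) n /\
            n + W u <= W (iter i nx u).
Proof.
move=> Qnx uQ; have iQ j : iter j nx u \in Q by elim: j => //= j; rewrite Qnx.
elim: i => [|i [n [dn Wn]]]; first by exists 0; split=> //; apply: dist_le_refl.
rewrite iterS; case: (boolP (stay (iter i nx u))) => [s|ns].
  by rewrite nx_stay //; exists n.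
have [nS ->] := nx_move ns.
exists n.+1; split; last exact: leq_ltn_trans Wn (W_pa ns).
rewrite -addn1; apply: (dist_le_trans dn); apply: dist_le_edge.
by rewrite /touching /= iQ /= andbT; apply: pa_edge.
Qed.

Lemma chain_dist_top (Q : {set G}) u :
  (forall v, (nx v \in Q) = (v \in Q)) -> u \in Q ->
  dist_le (touching Q) u (top u) (acc (top u)).
Proof.
move=> Qnx uQ; have [n [dn Wn]] := chain_dist K Qnx uQ.
apply: dist_le_weaken dn; rewrite -/(top u) in Wn.
by rewrite -ltnS; apply: leq_trans Wn; rewrite -addn1 leq_add2l.
Qed.

(** The end of the chain starting next to a group of [x]: from the parent if [x] closes a group
    itself, from [x], adjacent to its bins, otherwise. *)
Let anchor x := if full x then top (pa x) else top x.

(** Go down along the children that supplied the candidate: as long as [v] closes no bin, a child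
    that is not full hands its part to [v], which extends the chain from below. *)
Lemma cand_reach v a : ~~ full v -> cand v = a.+1 ->
  exists x, [/\ id x = a, full x || (0 < jE x) &
   if full x then x \notin S /\ exists i, iter i nx (pa x) = v
   else exists i, iter i nx x = v].
Proof.
have [n] := ubnP (c v); elim: n v => // n IH v lt_n nfv cv.
case: (posnP (jE v)) => jv; last first.
  exists v; rewrite (negPf nfv) jv; split=> //; last by exists 0.
  by apply: eq_add_S; rewrite -cv cand_own ?jv ?orbT.
have cmax := cand_desc nfv jv.
have [|w /andP[wS /eqP paw] cw] := @bigmax_gt0_exists _ (child v) cand.
  by rewrite -cmax cv.
rewrite -cmax cv in cw.
case: (boolP (full w)) => fw.
  exists w; rewrite fw; split=> //; last by split=> //; exists 0.
  by apply: eq_add_S; rewrite -cw cand_own ?fw.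
have cwv : c w < c v by rewrite -paw c_pa.
have [x [ix vx chx]] := IH w (leq_trans cwv lt_n) fw cw.
have nxw : nx w = v by rewrite /nx /stay (negPf fw) (negPf wS) paw jv.
exists x; split=> //; case: ifP chx => _ [] => [xS [i iw]|i iw].
  by split=> //; exists i.+1; rewrite iterS iw.
by exists i.+1; rewrite iterS iw.
Qed.

Lemma pa_chain v : exists r, [/\ r \in S, exists i, iter i pa v = r &
  dist_le (@edge G) v r (K - c v)].
Proof.
have H i : (iter i pa v \in S) || (i < c (iter i pa v)) /\
    exists n, dist_le (@edge G) v (iter i pa v) n /\ n + c v <= c (iter i pa v).
  elim: i => [|i [IH [n [dn cn]]]].
    by rewrite c_gt0 orbT; split=> //; exists 0; split=> //; apply: dist_le_refl.
  rewrite iterS; case: (boolP (_ \in S)) IH => [s _|ns /= lt_i].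
    by rewrite pa_root ?s //; split=> //; exists n.
  rewrite c_pa // ltnS lt_i orbT; split=> //; exists n.+1; split; last by [].
  by rewrite -addn1; apply: (dist_le_trans dn); apply: dist_le_edge; apply: pa_edge.
have [/orP[rS|lt_K] [n [dn cn]]] := H K; last by rewrite ltnNge c_le in lt_K.
exists (iter K pa v); split=> //; first by exists K.
by apply: dist_le_weaken dn; have := c_root rS; lia.
Qed.

(** A zero candidate excludes groups in the whole subtree, so every part is passed on and the chains
    of [pa] and [nx] agree. *)
Lemma cand0_chain v i w : cand v = 0 -> iter i pa w = v ->
  iter i nx w = v /\ cand w = 0.
Proof.
move=> cv; elim: i w => [|i IH] w; first by move=> /= ->.
rewrite !iterSr => /IH [iv cpa].
case: (boolP (w \in S)) => wS.
  by rewrite nx_stay ?/stay ?wS ?orbT // -{1 2}(pa_root wS).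
have: ~~ (full (pa w) || (0 < jE (pa w))).
  by apply/negP => /cand_own; rewrite cpa.
rewrite negb_or -eqn0Ngt => /andP[nf /eqP j0].
have cw : cand w = 0.
  apply/eqP; rewrite -leqn0 -cpa (cand_desc nf j0).
  by rewrite (leq_bigmax_cond (F := cand)) // /child wS eqxx.
split=> //; rewrite /nx /stay (negPf wS) j0 /= orbF.
by case: ifP => // /(fun h => cand_own (introT orP (or_introl h))); rewrite cw.
Qed.

(* Without a group below the root s, its whole tree has at most f nodes, hence
   depth less than f; as the roots are 2f + 2 apart, no neighbour of the tree
   can belong to another tree, so that G itself has at most f nodes. *)
Lemma cand_root s : s \in S -> ~~ full s -> 0 < cand s.
Proof.
move=> sS nfs; rewrite lt0n; apply/eqP => cs0.
have accs : acc s < f by rewrite ltn_neqAle nfs acc_le.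
have ss : stay s by rewrite /stay sS orbT.
have setTnx v : (nx v \in [set: G]) = (v \in [set: G]) by rewrite !inE.
have c_top u : top u = s -> c s <= c u + acc s.
  move=> tu; suff H i : c (iter i nx u) + W u <= c u + W (iter i nx u).
    by have := H K; rewrite -/(top u) tu /W; lia.
  elim: i => [//|i IH]; rewrite iterS; case: (boolP (stay (iter i nx u))) => [s'|ns].
    by rewrite nx_stay.
  by have [nS ->] := nx_move ns; have := W_pa ns; rewrite c_pa //; lia.
have step u w : edge u w -> top u = s -> top w = s.
  move=> euw tu; have [r [rS [i ir] dr]] := pa_chain w.
  have ers : r = s.
    apply/eqP; apply/negPn/negP => nrs.
    have [n [dn Wn]] := chain_dist K setTnx (in_setT u).
    have d1 : dist_le (@edge G) u s n.
      move: dn; rewrite -/(top u) tu => -[p [p1 p2 p3]]; exists p; split=> //.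
      by apply: sub_path p1 => a b /andP[].
    have d2 : dist_le (@edge G) r u ((K - c w) + 1).
      apply: dist_le_trans (dist_le_sym (@edge_sym G) dr) _.
      by apply: dist_le_edge; rewrite edge_sym.
    have [p [p1 p2 p3]] := dist_le_trans d2 d1.
    (* The depth of [u] is at most [acc s], that of [w] at most one more, so the two roots would be
       within 2 [acc s] + 2, hence within 2f. *)
    have := S_sep rS sS nrs p1 p2; rewrite -/(top u) tu in Wn.
    have := c_nbr euw; have := c_root sS; have := c_top u tu.
    by rewrite /W /K in Wn *; lia.
  by have [iw _] := cand0_chain cs0 (etrans ir ers); apply: top_unique iw.
have alls u : top u = s.
  suff walk p x : top x = s -> path (@edge G) x p -> top (last x p) = s.
    have /connectP[p pp ->] := Gconn s u.
    by apply: walk pp; apply: (@top_unique s s 0).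
  elim: p x => [//|y p IH] x tx /= /andP[exy]; apply: IH; exact: step tx.
have := class_card setTnx; rewrite cardsT (big_pred1 s) => [|v]; last first.
  rewrite inE /=; apply/idP/eqP => [sv|-> //].
  by rewrite -(alls v) /top iter_nx_stay.
by rewrite /W; lia.
Qed.

Lemma root_cand s : s \in S -> ~~ full s ->
  exists x, [/\ (cand s).-1 = id x, full x || (0 < jE x), anchor x = s &
                full x -> x \notin S].
Proof.
move=> sS nfs; have := cand_root sS nfs; case cs: (cand s) => [//|a] _.
have [x [ix vx chx]] := cand_reach nfs cs; exists x; rewrite /anchor.
have ss : stay s by rewrite /stay sS orbT.
case: (full x) vx chx => vx [] => [xS [i iw]|i iw]; split=> //; exact: top_unique iw.
Qed.

(** As [nx] preserves [og], the name can be read at the end of the chain. Closed bins of [x] have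
    numbers below [jE x], which leaves [jE x] for the group that a full [x] closes itself. *)
Lemma og_valid v : exists x j,
  og v = (id x, j) /\ (j < jE x) || (full x && (j == jE x)).
Proof.
rewrite -(og_iter v K) -/(top v); have := stay_top v; move: (top v) => t st.
rewrite ogE; case: (boolP (full t)) => ft.
  by exists t, (jE t); rewrite ft eqxx orbT.
case: (boolP (t \in S)) => tS.
  have [x [-> vx _ _]] := root_cand tS ft; exists x, 0; split=> //.
  by case: (posnP (jE x)) vx => // ->; rewrite orbF => ->.
move: st; rewrite /stay (negPf ft) (negPf tS) /= => lt_l; rewrite lt_l.
by exists (pa t), (lab t); rewrite lt_l.
Qed.

Lemma group_nx n v : (nx v \in [set u | og u == n]) = (v \in [set u | og u == n]).
Proof. by rewrite !inE og_nx. Qed.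

(** By [class_card] the size is the total weight of the chain ends in the group: [A] collects the
    parts left at roots, [B] the original bin or full part. *)
Lemma group_size v : f + 1 <= #|[set u | og u == og v]| <= 3 * f + 1.
Proof.
have [x [j [-> vxj]]] := og_valid v.
set Q := [set u | _]; rewrite (class_card (group_nx _)) -/Q.
rewrite (bigID (fun t => ~~ full t && (t \in S))) /=.
set A := (X in (_ <= X + _) && _); set B := (X in (_ <= _ + X) && _).
(* The name determines [x], and a root joining a group of [x] is [anchor x]: at most one root part
   is added. *)
have A_le : A <= f.
  pose P t := [&& t \in Q, stay t & ~~ full t && (t \in S)].
  have PE t : P t -> t = anchor x /\ W t <= f.
    case/and3P; rewrite inE => /eqP ot _ /andP[nft tS].
    have [y [cy _ ay _]] := root_cand tS nft.
    rewrite ogE (negPf nft) tS cy in ot; case: ot => /id_inj exy _.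
    by split; [rewrite -ay exy | rewrite /W ltn_neqAle nft acc_le].
  rewrite /A (eq_bigl P) => [|t]; last by rewrite /P -andbA.
  case: (pickP P) => [t Pt|P0]; last by rewrite big_pred0.
  rewrite (big_pred1 t); first by have [] := PE t Pt.
  move=> u; apply/idP/eqP => [/PE[-> _]|-> //].
  by have [-> _] := PE t Pt.
suff: f < B <= 2 * f + 1 by lia.
case: (ltnP j (jE x)) vxj => [lt_j _|le_j /= /andP[fx /eqP jx]].
  (* In a bin of [x], the other chain ends are the children packed there; full children have size
     0. *)
  suff -> : B = \sum_(w | child x w && (lab w == j)) sz w by have := binP lt_j; lia.
  rewrite /B big_mkcond [RHS]big_mkcond; apply: eq_bigr => t _.
  rewrite inE ogE /child /stay /sz.
  case: (boolP (full t)) => /= ft.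
    case: ifP => [|_]; last by case: ifP.
    rewrite !andbT => /eqP[/id_inj etx ejj].
    by rewrite -ejj etx ltnn in lt_j.
  case: (t \in S) => /=; first by rewrite !andbF.
  rewrite andbT; case: (ltnP (lab t) (jE (pa t))) => lt_l.
    by rewrite andbT xpair_eqE (inj_eq id_inj).
  rewrite andbF; case: ifP => // /andP[/eqP pat /eqP lt].
  by rewrite pat lt leqNgt lt_j in lt_l.
(* For the group of a full [x], the only other chain end is [x], of weight f + 1. *)
suff -> : B = W x by rewrite /W (eqP fx); lia.
rewrite /B; apply: big_pred1 => t; rewrite inE ogE /stay.
case: (boolP (full t)) => /= ft.
  rewrite !andbT xpair_eqE (inj_eq id_inj) jx.
  by apply/andP/eqP => [[/eqP]|->].
have -> : (t == x) = false by apply: contraNF ft => /eqP->.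
case: (t \in S) => /=; first by rewrite andbF.
rewrite andbT; case: (ltnP (lab t) (jE (pa t))) => lt_l; rewrite ?andbF // andbT.
rewrite xpair_eqE (inj_eq id_inj); apply/negP => /andP[/eqP pat /eqP lt].
by rewrite pat lt jx ltnn in lt_l.
Qed.

(** The centre is the node [x] naming the group; it need not belong to the group when this is a bin,
    but the last edge then touches the group. *)
Lemma group_radius v : exists x, forall u, og u = og v ->
  dist_le (touching [set u | og u == og v]) u x (2 * f - 1).
Proof.
have [x [j [-> vxj]]] := og_valid v; exists x => u ou.
set Q := [set u | _]; have Qnx := group_nx (id x, j); rewrite -/Q in Qnx.
have uQ : u \in Q by rewrite inE ou.
have := chain_dist_top Qnx uQ; have := stay_top u.
have : og (top u) = (id x, j) by rewrite og_iter.
move: (top u) => t ot st.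
have tQ : t \in Q by rewrite inE ot.
move: (ot); rewrite ogE; case: (boolP (full t)) => ft.
  by case=> /id_inj <- _; apply: dist_le_weaken; rewrite (eqP ft); lia.
have acc_lt y : ~~ full y -> acc y < f by move=> ?; rewrite ltn_neqAle acc_le andbT.
have at_lt := acc_lt _ ft.
case: (boolP (t \in S)) => tS.
  have [y [-> _ ay ny]] := root_cand tS ft; case=> exy _ dut.
  have {exy} eyx := id_inj exy; rewrite {}eyx in ay ny.
  (* At most f - 1 edges lead from [u] to the root [t], so f are left between [t] and [x]. *)
  suff dtx : dist_le (touching Q) x t f.
    apply: dist_le_weaken (dist_le_trans dut (dist_le_sym (@touching_sym _ _) dtx)).
    by lia.
  move: ay ny; rewrite /anchor; case: (boolP (full x)) => fx ay ny.
    have pQ : pa x \in Q by rewrite inE -(og_iter _ K) -/(top _) ay ot.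
    have exp : touching Q x (pa x) by rewrite /touching /= pQ orbT pa_edge ?ny.
    have := chain_dist_top Qnx pQ; rewrite ay.
    move=> /(dist_le_trans (dist_le_edge exp)); apply: dist_le_weaken.
    by rewrite add1n.
  have xQ : x \in Q by rewrite inE -(og_iter _ K) -/(top _) ay ot.
  by have := chain_dist_top Qnx xQ; rewrite ay; apply: dist_le_weaken; lia.
move: st; rewrite /stay (negPf ft) (negPf tS) /= => -> [/id_inj pat _] dut.
have etx : touching Q t x by rewrite /touching /= tQ -pat pa_edge.
by apply: dist_le_weaken (dist_le_trans dut (dist_le_edge etx)); lia.
Qed.

End Forest.

(** * Coding messages *)

(** Each binary digit, lowest first, follows a [true], and [false] ends the number: the code is
    self-delimiting. Fuel [n] is enough for [n]. *)
Fixpoint encode_nat_fuel (k n : nat) : seq bool :=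
  if k is k'.+1 then
    if n == 0 then [:: false] else [:: true, odd n & encode_nat_fuel k' n./2]
  else [:: false].

Definition encode (m : seq nat) : message :=
  flatten [seq encode_nat_fuel n n | n <- m].

Fixpoint decode (b : message) : seq nat :=
  match b with
  | false :: b' => 0 :: decode b'
  | true :: d :: b' => if decode b' is n :: m then d + n.*2 :: m else [::]
  | _ => [::]
  end.

Lemma decode_nat k n b :
  n <= k -> decode (encode_nat_fuel k n ++ b) = n :: decode b.
Proof.
elim: k n => [|k IH] n; first by rewrite leqn0 => /eqP->.
have [-> //|n0 le_n] := eqVneq n 0.
rewrite /= (negPf n0) /= IH ?odd_double_half //.
by rewrite -ltnS; apply: leq_trans le_n; rewrite -divn2; lia.
Qed.

Lemma encodeK : cancel encode decode.
Proof. by elim=> [//|n m IH]; rewrite /encode /= decode_nat // [decode _]IH. Qed.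

Lemma size_encode_nat k M n : n < 2 ^ M -> size (encode_nat_fuel k n) <= M.*2.+1.
Proof.
elim: k M n => [|k IH] M n //=; case: eqP => //= n0.
case: M => [|M]; first by rewrite expn0; lia.
by rewrite expnS => lt_n; rewrite doubleS !ltnS; apply: IH; lia.
Qed.

Lemma size_encode M m :
  all (fun n => n < 2 ^ M) m -> size (encode m) <= size m * M.*2.+1.
Proof.
elim: m => [//|n m IH] /= /andP[lt_n /IH]; rewrite /encode /= size_cat mulSn.
by apply: leq_add; apply: size_encode_nat.
Qed.

(** * Greedy packing *)

Section Packing.
Variable f : nat.

(* The state is the load of the current bin and its number; a bin is left as
   soon as its load exceeds f. *)
Definition pack_step (a : nat * nat) (z : nat) : nat * nat :=
  if f < a.1 + z then (0, a.2.+1) else (a.1 + z, a.2).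

Definition pack (zs : seq nat) : nat * nat := foldl pack_step (0, 0) zs.

(** An item belongs to the bin open on its arrival, even if it closes that bin; hence the strict
    prefix. *)
Definition bin_of (zs : seq nat) (i : nat) : nat := (pack (take i zs)).2.

Definition load (zs : seq nat) (j : nat) : nat :=
  \sum_(i < size zs | bin_of zs i == j) nth 0 zs i.

Lemma pack_rcons s z : pack (rcons s z) = pack_step (pack s) z.
Proof. by rewrite /pack -cats1 foldl_cat. Qed.

Lemma pack_le zs : (pack zs).1 <= f.
Proof.
elim/last_ind: zs => [//|s z IH]; rewrite pack_rcons /pack_step.
by case: ltnP.
Qed.

Lemma pack_cat s t : (pack s).2 <= (pack (s ++ t)).2.
Proof.
elim/last_ind: t => [|t z IH]; first by rewrite cats0.
rewrite -rcons_cat pack_rcons /pack_step; case: ifP => _ //=.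
exact: leq_trans IH _.
Qed.

Lemma pack_bins zs : (pack zs).2 <= size zs.
Proof.
elim/last_ind: zs => [//|s z IH]; rewrite pack_rcons size_rcons /pack_step.
by case: ifP => _ //=; apply: leq_trans IH _.
Qed.

Lemma bin_of_le zs i : bin_of zs i <= (pack zs).2.
Proof. by rewrite -{2}(cat_take_drop i zs) pack_cat. Qed.

Lemma load_rcons s z j :
  load (rcons s z) j = load s j + (if (pack s).2 == j then z else 0).
Proof.
rewrite /load size_rcons big_mkcond big_ord_recr /= [in RHS]big_mkcond /=.
congr (_ + _); last by rewrite /bin_of -cats1 take_size_cat // nth_cat ltnn subnn.
apply: eq_bigr => i _; rewrite /bin_of -cats1 take_cat nth_cat.
by have := ltn_ord i; case: ltnP.
Qed.

(** Before its last item a closed bin has load at most f, and that item, of size at most f, lifts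
    the load above f. *)
Lemma load_spec zs : all (fun z => z <= f) zs ->
  [/\ load zs (pack zs).2 = (pack zs).1,
      forall j, j < (pack zs).2 -> f < load zs j <= 2 * f
    & forall j, (pack zs).2 < j -> load zs j = 0].
Proof.
elim/last_ind: zs => [_|s z IH]; first by split=> // [|j _]; rewrite /load big_ord0.
rewrite all_rcons => /andP[z_le /IH[l1 l2 l3]].
have p_le := pack_le s.
rewrite pack_rcons /pack_step; case: ltnP => /= lt_f.
  split=> [|j|j]; rewrite load_rcons.
  - by rewrite l3 // ltn_eqF.
  - rewrite ltnS leq_eqVlt => /orP[/eqP->|lt_j].
      by rewrite eqxx l1; lia.
    by rewrite gtn_eqF // addn0 l2.
  - by move=> lt_j; rewrite l3 ?ltn_eqF //; lia.
split=> [|j lt_j|j lt_j]; rewrite load_rcons ?eqxx ?l1 //.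
- by rewrite gtn_eqF // addn0 l2.
- by rewrite ltn_eqF // l3.
Qed.

End Packing.

(** * The algorithm *)

(* A message lists: the closeness 2f + 2 - dist(v, S) of the sender v; whether
   the receiver is its parent; the size of its pending part (0 if it has
   joined a full group); 1 + the identifier of a node having groups in its
   subtree (0 if there is none); the name of the group of v; and the name of
   the group of the pending part of the receiver, should it be a child. *)
Definition m_close (m : seq nat) := nth 0 m 0.
Definition m_parent (m : seq nat) := nth 0 m 1 == 1.
Definition m_pending (m : seq nat) := nth 0 m 2.
Definition m_cand (m : seq nat) := nth 0 m 3.
Definition m_group (m : seq nat) := (nth 0 m 4, nth 0 m 5).
Definition m_child_group (m : seq nat) := (nth 0 m 6, nth 0 m 7).

Section Node.
Variables (x : local_input) (ib : seq (seq nat)).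

Definition closeness : nat :=
  if in_ruling x then 2 * in_f x + 2 else (\max_(m <- ib) m_close m).-1.

(** For a root the value [size ib] is no port, so that no neighbour is told to be its parent. *)
Definition parent_port : nat :=
  if in_ruling x then size ib
  else find (fun m => m_close m == \max_(m <- ib) m_close m) ib.

(** Ports without a child keep an entry, so positions remain port numbers; zeros change neither the
    packing nor the maximum. *)
Definition kids : seq (nat * nat) :=
  [seq if m_parent m then (m_pending m, m_cand m) else (0, 0) | m <- ib].

Definition parent_group : nat * nat :=
  if in_ruling x then (0, 0) else m_child_group (nth [::] ib parent_port).

Variables (ks : seq (nat * nat)) (g : nat * nat).

Definition node_pack : nat * nat := pack (in_f x) (unzip1 ks).

Definition node_full : bool := node_pack.1 == in_f x.

Definition pending : nat := if node_full then 0 else node_pack.1.+1.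

Definition candidate : nat :=
  if node_full || (0 < node_pack.2) then (in_id x).+1 else \max_(k <- ks) k.2.

Definition node_group : nat * nat :=
  if node_full then (in_id x, node_pack.2)
  else if in_ruling x then (candidate.-1, 0) else g.

Definition child_group (p : nat) : nat * nat :=
  let j := bin_of (in_f x) (unzip1 ks) p in
  if j < node_pack.2 then (in_id x, j) else node_group.

End Node.

Definition node_message (x : local_input) (ib : seq (seq nat)) (p : nat) :
    seq nat :=
  let ks := kids ib in
  let g := parent_group x ib in
  [:: closeness x ib; nat_of_bool (p == parent_port x ib); pending x ks;
      candidate x ks; (node_group x ks g).1; (node_group x ks g).2;
      (child_group x ks g p).1; (child_group x ks g p).2].

Definition node_output (x : local_input) (ib : seq (seq nat)) : local_output :=
  let own := pickle (node_group x (kids ib) (parent_group x ib)) in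
  LocalOutput own (fun p => [:: own; pickle (m_group (nth [::] ib p))]).

(** One delay of 2f + 2 for each phase, and a few rounds for the passage from one phase to the
    next. *)
Definition rounds (f : nat) : nat := 3 * (2 * f + 2) + 4.

(* A node remembers its input, the number of the current round, and what it
   received last. *)
Definition grouping : algorithm local_input local_output :=
  @Algorithm local_input local_output (local_input * nat * seq (seq nat))
    (fun x => (x, 0, nseq (in_degree x) [::]))
    (fun s p => Some (encode (node_message s.1.1 s.2 p)))
    (fun s inb => (s.1.1, s.1.2.+1,
                   [seq if o is Some b then decode b else [::] | o <- inb]))
    (fun s => if s.1.2 < rounds (in_f s.1.1) then None
              else Some (node_output s.1.1 s.2)).

(** * Stabilization of the messages *)

Section Run.
Variables (f : nat) (G : sgraph) (id : G -> nat) (ports : G -> seq G).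
Variable S : {set G}.
Hypothesis f_gt0 : 0 < f.
Hypothesis portsP : port_numbering ports.
Hypothesis S_ruling : ruling_set (2 * f + 2) (2 * f + 1) S.

Let K := 2 * f + 2.
Let x := inputs f id S ports.

(* The message that v sends to u in round t - 1, empty for t = 0. *)
Fixpoint msg (t : nat) (v u : G) : seq nat :=
  if t is t'.+1 then
    node_message (x v) [seq msg t' w v | w <- ports v] (index u (ports v))
  else [::].

Definition received (t : nat) (v : G) : seq (seq nat) :=
  [seq msg t w v | w <- ports v].

Lemma mem_ports u v : (u \in ports v) = edge v u.
Proof. by have [_ ->] := portsP v; rewrite inE. Qed.

Lemma ports_uniq v : uniq (ports v).
Proof. by have [] := portsP v. Qed.

Lemma nth_received t v u : u \in ports v ->
  nth [::] (received t v) (index u (ports v)) = msg t u v.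
Proof. by move=> pu; rewrite (nth_map v) ?index_mem // nth_index. Qed.

Lemma execE r v : exec grouping ports x r v =
  (x v, minn r (rounds f), received (minn r (rounds f)) v).
Proof.
elim: r v => [|r IH] v /=.
  rewrite min0n /received /=; congr (_, _, _).
  by elim: (ports v) => //= w s ->.
rewrite IH /=; case: (ltnP r (rounds f)) => r_lt; last first.
  by rewrite ltnn (minn_idPr (leqW r_lt)).
rewrite r_lt (minn_idPl r_lt); congr (_, _, _).
rewrite /inbox -map_comp; apply: eq_map => u /=.
by rewrite /sent IH /= (minn_idPl (ltnW r_lt)) r_lt encodeK.
Qed.

Let C t v := closeness (x v) (received t v).

Lemma C_root t v : v \in S -> C t v = K.
Proof. by move=> vS; rewrite /C /closeness /= vS. Qed.

Lemma max_received t v :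
  \max_(m <- received t.+1 v) m_close m = \max_(w <- ports v) C t w.
Proof. by rewrite big_map. Qed.

Lemma C_step t v : v \notin S -> C t.+1 v = (\max_(w <- ports v) C t w).-1.
Proof. by move=> vS; rewrite /C /closeness /= (negPf vS) max_received. Qed.

Lemma C_init v : v \notin S -> C 0 v = 0.
Proof.
move=> vS; rewrite /C /closeness /= (negPf vS) /received big_map.
by rewrite big1_seq.
Qed.

Lemma C_le t v : C t v <= K.
Proof.
elim: t v => [|t IH] v; (case: (boolP (v \in S)) => vS; first by rewrite C_root).
  by rewrite C_init.
rewrite C_step //; apply: leq_trans (leq_pred _) _.
by apply/bigmax_leqP_seq => w _ _.
Qed.

Lemma C_mono t v : C t v <= C t.+1 v.
Proof.
elim: t v => [|t IH] v; (case: (boolP (v \in S)) => vS; first by rewrite !C_root).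
  by rewrite C_init.
rewrite !C_step // -!subn1 leq_sub2r //.
apply/bigmax_leqP_seq => w pw _; apply: leq_trans (IH w) _.
by apply: (leq_bigmax_seq (F := C t.+1) w).
Qed.

(** An increase at [v] stems from one at a neighbour a round earlier and loses one on the way, so
    the values that can still be reached by an increase shrink with [t]. *)
Lemma C_gap t v : C t.+1 v <= maxn (C t v) (K - t).
Proof.
elim: t v => [|t IH] v; (case: (boolP (v \in S)) => vS;
  first by rewrite !C_root // leq_maxl).
  by rewrite subn0 leq_max C_le orbT.
have [|lt0] := posnP (C t.+2 v); first by move->.
suff: \max_(w <- ports v) C t.+1 w <= maxn (C t.+1 v).+1 (K - t).
  by rewrite C_step // in lt0 *; lia.
apply/bigmax_leqP_seq => w pw _; apply: leq_trans (IH w) _.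
rewrite geq_max leq_maxr andbT leq_max; apply/orP; left.
rewrite C_step //; apply: leq_trans (leqSpred _).
by apply: (leq_bigmax_seq (F := C t) w).
Qed.

Let c v := C K v.

Lemma C_stable t v : K <= t -> C t v = c v.
Proof.
move=> le_t; rewrite -(subnKC le_t); elim: (t - K) => [|d IH]; first by rewrite addn0.
rewrite addnS; apply/eqP; rewrite eqn_leq -IH C_mono andbT.
by have := C_gap (K + d) v; rewrite (eqP (leq_addr d K)) maxn0.
Qed.

Lemma c_root v : v \in S -> c v = K.
Proof. exact: C_root. Qed.

Lemma c_step v : v \notin S -> c v = (\max_(w <- ports v) c w).-1.
Proof. by move=> vS; rewrite -(C_stable v (leqnSn K)) C_step. Qed.

Lemma c_nbr u v : edge u v -> c u <= (c v).+1.
Proof.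
move=> euv; case: (boolP (v \in S)) => vS; first by rewrite (c_root vS) leqW ?C_le.
rewrite (c_step vS); apply: leq_trans (leqSpred _).
by apply: (leq_bigmax_seq (F := c) u); rewrite // mem_ports edge_sym.
Qed.

(** Some walk of at most 2f + 1 = K - 1 edges leads to [S], where [c] is [K], and [c] changes by at
    most one per edge. *)
Lemma c_gt0 v : 0 < c v.
Proof.
have [w wS [p [p1 p2 p3]]] := S_ruling.2 v.
suff: c (last v p) <= c v + size p by rewrite p2 c_root // /K; lia.
elim: p v p1 {p2 p3} => [|y p IH] v /=; first by rewrite addn0.
case/andP=> evy /IH le1; have /c_nbr le2 : edge y v by rewrite edge_sym.
by apply: leq_trans le1 _; rewrite addnS -addSn leq_add2r.
Qed.

Let PP t v := parent_port (x v) (received t v).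
Let pp v := PP K.+1 v.
Let pa v := nth v (ports v) (pp v).
Let child v w := (w \notin S) && (pa w == v).

Lemma PP_eq t v : K < t -> PP t v = if v \in S then size (ports v)
  else find (fun w => c w == \max_(w <- ports v) c w) (ports v).
Proof.
case: t => // t le_t; rewrite /PP /parent_port /= size_map; case: ifP => // _.
rewrite max_received find_map (eq_big_seq c) => [|w _]; last exact: C_stable.
by apply: eq_find => w /=; rewrite /m_close /= -/(C t w) C_stable.
Qed.

Lemma ppE v : pp v = if v \in S then size (ports v)
  else find (fun w => c w == \max_(w <- ports v) c w) (ports v).
Proof. exact: PP_eq. Qed.

Lemma PP_stable t v : K < t -> PP t v = pp v.
Proof. by move=> lt_t; rewrite ppE PP_eq. Qed.

Lemma pa_root v : v \in S -> pa v = v.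
Proof. by move=> vS; rewrite /pa ppE vS nth_default. Qed.

Lemma pp_lt v : v \notin S -> pp v < size (ports v).
Proof.
move=> vS; rewrite ppE (negPf vS) -has_find; apply/hasP.
have := c_gt0 v; rewrite c_step // => max_gt0.
have: 0 < \max_(w <- ports v) c w by lia.
elim: (ports v) => [|w s IH]; rewrite ?big_nil // big_cons.
case: (leqP (c w) (\max_(w <- s) c w)) => le_w lt0.
  have [w' ws /eqP cw'] := IH lt0; exists w'; first by rewrite inE ws orbT.
  by rewrite cw'.
by exists w; rewrite ?inE ?eqxx.
Qed.

Lemma pa_edge v : v \notin S -> edge v (pa v).
Proof. by move=> vS; rewrite -mem_ports mem_nth // pp_lt. Qed.

Lemma c_pa v : v \notin S -> c (pa v) = (c v).+1.
Proof.
move=> vS; have := pp_lt vS; rewrite {1}ppE (negPf vS) -has_find => /(nth_find v).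
rewrite /pa ppE (negPf vS) => /eqP->; have := c_gt0 v; rewrite c_step //; lia.
Qed.

Lemma parent_bit v w : edge v w -> (index v (ports w) == pp w) = child v w.
Proof.
move=> evw; have pv : v \in ports w by rewrite mem_ports edge_sym.
rewrite /child; case: (boolP (w \in S)) => wS /=.
  by rewrite ppE wS; rewrite -index_mem in pv; rewrite ltn_eqF.
apply/eqP/eqP => [ip|<-]; first by rewrite /pa -ip nth_index.
by rewrite /pa index_uniq ?ports_uniq ?pp_lt.
Qed.

Lemma child_edge v w : child v w -> edge v w.
Proof. by case/andP=> wS /eqP <-; rewrite edge_sym pa_edge. Qed.

Let ks t v := kids (received t v).

Lemma kids_step t v : K < t -> ks t.+1 v =
  [seq if child v w then (pending (x w) (ks t w), candidate (x w) (ks t w))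
       else (0, 0) | w <- ports v].
Proof.
move=> le_t; rewrite /ks /kids -map_comp; apply/eq_in_map => w pw /=.
rewrite /m_parent /= -/(PP t w) PP_stable // parent_bit -?mem_ports //.
by case: child.
Qed.

(** With the parents fixed, sizes settle upwards, one level per round: children have smaller [c]. *)
Lemma kids_stable t v : K + 2 + c v <= t -> ks t.+1 v = ks t v.
Proof.
have [n] := ubnP (c v); elim: n t v => // n IH [|t] v lt_n le_t; first by lia.
rewrite !kids_step; try lia.
apply/eq_in_map => w pw; case: (boolP (child v w)) => // /andP[wS /eqP paw].
by have := c_pa wS; rewrite paw => cv; rewrite IH //; lia.
Qed.

Let g t v := parent_group (x v) (received t v).

Lemma group_step t v : K < t -> v \notin S -> g t.+1 v =
  child_group (x (pa v)) (ks t (pa v)) (g t (pa v)) (index v (ports (pa v))).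
Proof.
move=> le_t vS; rewrite /g /parent_group /= (negPf vS) -/(PP t.+1 v).
rewrite PP_stable; last by rewrite ltnW.
rewrite /received (nth_map v) ?pp_lt // -/(pa v) /m_child_group /=.
by rewrite -surjective_pairing.
Qed.

(** With the sizes fixed, names settle downwards, one level per round. *)
Lemma group_stable t v : 2 * K + 3 + (K - c v) <= t -> g t.+1 v = g t v.
Proof.
have [n] := ubnP (K - c v); elim: n t v => // n IH [|t] v lt_n le_t; first by lia.
case: (boolP (v \in S)) => vS; first by rewrite /g /parent_group /= vS.
have cp := c_pa vS; have := C_le K (pa v); rewrite -/(c _) => c_le.
rewrite [LHS]group_step ?[RHS]group_step ?kids_stable ?IH //; lia.
Qed.

Let T := rounds f.

Lemma msg_stable v u : msg T.+1 v u = msg T v u.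
Proof.
have cK := C_le K v; rewrite -/(c v) in cK.
have -> : T = (3 * K + 3).+1 by rewrite /T /rounds -/K; lia.
set t := 3 * K + 3.
rewrite -[LHS]/(node_message (x v) (received t.+1 v) _).
rewrite -[RHS]/(node_message (x v) (received t v) _) /node_message.
rewrite -!/(ks _ _) -!/(g _ _) -!/(C _ _) -!/(PP _ _).
by rewrite kids_stable ?group_stable ?C_stable ?PP_stable //; rewrite /t; lia.
Qed.

(** * The forest and the groups given by the stationary messages *)

Hypothesis cardG : f < #|G|.
Hypothesis Gconn : connected_graph G.
Hypothesis id_inj : injective id.

Let kT v := ks T v.
Let acc v := (node_pack (x v) (kT v)).1.
Let bins v := (node_pack (x v) (kT v)).2.
Let lab w := bin_of f (unzip1 (kT (pa w))) (index w (ports (pa w))).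
Let cand v := candidate (x v) (kT v).
Let sz v := if acc v == f then 0 else (acc v).+1.

Definition final_group (v : G) : nat * nat := node_group (x v) (kT v) (g T v).

Lemma c_le v : c v <= K.
Proof. exact: C_le. Qed.

Lemma final_kids v :
  kT v = [seq if child v w then (sz w, cand w) else (0, 0) | w <- ports v].
Proof.
have T_ge : 3 * K + 4 <= T by rewrite /T /rounds.
by have := c_le v => cv; rewrite -[LHS]kids_stable ?kids_step //; lia.
Qed.

Lemma sum_ports (v : G) (P : G -> nat -> bool) (F : G -> nat) :
  \sum_(i < size (ports v) | P (nth v (ports v) i) i) F (nth v (ports v) i)
  = \sum_(w | edge v w && P w (index w (ports v))) F w.
Proof.
rewrite (eq_bigl (fun w => (w \in ports v) && P w (index w (ports v)))); last first.
  by move=> w; rewrite mem_ports.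
rewrite big_mkcondr -big_uniq ?ports_uniq // (big_nth v) big_mkord.
by rewrite big_mkcond; apply: eq_bigr => i _; rewrite index_uniq ?ports_uniq.
Qed.

Lemma final_load v j : load f (unzip1 (kT v)) j =
  \sum_(w | child v w && (lab w == j)) sz w.
Proof.
rewrite /load size_map; have -> : size (kT v) = size (ports v).
  by rewrite final_kids size_map.
pose F w := if child v w then sz w else 0.
rewrite (eq_bigr (fun i : 'I_(size (ports v)) => F (nth v (ports v) i))).
  rewrite (sum_ports v (fun _ i => bin_of f (unzip1 (kT v)) i == j)).
  rewrite big_mkcond [RHS]big_mkcond; apply: eq_bigr => w _; rewrite /F.
  case: (boolP (child v w)) => [cvw|]; last by case: ifP.
  rewrite child_edge //=; move: cvw; rewrite /lab => /andP[_ /eqP->].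
  by [].
move=> i _; rewrite final_kids /unzip1 -map_comp (nth_map v) //= /F.
by case: child.
Qed.

Lemma final_load_spec v :
  [/\ load f (unzip1 (kT v)) (bins v) = acc v,
      forall j, j < bins v -> f < load f (unzip1 (kT v)) j <= 2 * f
    & forall j, bins v < j -> load f (unzip1 (kT v)) j = 0].
Proof.
apply: load_spec; rewrite final_kids /unzip1 -map_comp all_map; apply/allP => w _ /=.
case: ifP => // _ /=; rewrite /sz; case: eqP => // /eqP nf.
by rewrite ltn_neqAle nf pack_le.
Qed.

(** What stays with [v] is the load of the bin still open, whose number [bins v] is the largest
    label. *)
Lemma accE v : acc v = \sum_(w | child v w && (bins v <= lab w)) sz w.
Proof.
have [<- _ _] := final_load_spec v; rewrite final_load; apply: eq_bigl => w.
case: (boolP (child v w)) => //= /andP[_ /eqP paw].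
by rewrite /lab paw eqn_leq bin_of_le.
Qed.

Lemma binP v j : j < bins v ->
  f < \sum_(w | child v w && (lab w == j)) sz w <= 2 * f.
Proof. by move=> lt_j; have [_ + _] := final_load_spec v; rewrite -final_load; apply. Qed.

Lemma cand_own v : (acc v == f) || (0 < bins v) -> cand v = (id v).+1.
Proof. by move=> h; rewrite /cand /candidate /node_full ifT. Qed.

Lemma cand_desc v : acc v != f -> bins v = 0 ->
  cand v = \max_(w | child v w) cand w.
Proof.
move=> nf j0; rewrite {1}/cand /candidate /node_full -/(acc v) -/(bins v) j0 orbF.
rewrite ifN // final_kids big_map big_uniq ?ports_uniq //=.
rewrite big_mkcond [RHS]big_mkcond; apply: eq_bigr => w _.
rewrite mem_ports; case: (boolP (child v w)) => [/child_edge -> //|].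
by case: ifP.
Qed.

Lemma final_groupE v : final_group v =
  if acc v == f then (id v, bins v) else if v \in S then ((cand v).-1, 0)
  else if lab v < bins (pa v) then (id (pa v), lab v) else final_group (pa v).
Proof.
rewrite /final_group {1}/node_group /node_full -/(acc v) /=.
case: ifP => // _; case: ifP => // /negbT vS.
have T_ge : 3 * K + 4 <= T by rewrite /T /rounds.
by have cv := c_le v; rewrite -[LHS]group_stable ?group_step //; lia.
Qed.

Lemma final_group_size v :
  f + 1 <= #|[set u | final_group u == final_group v]| <= 3 * f + 1.
Proof.
apply: (group_size f_gt0 cardG Gconn id_inj S_ruling.1 c_le c_gt0 c_root c_nbr
  pa_root pa_edge c_pa _ accE binP cand_own cand_desc final_groupE) => w.
exact: pack_le.
Qed.

Lemma final_group_radius v : exists y, forall u, final_group u = final_group v ->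
  dist_le (touching [set u | final_group u == final_group v]) u y (2 * f - 1).
Proof.
apply: (group_radius f_gt0 cardG Gconn id_inj S_ruling.1 c_le c_gt0 c_root c_nbr
  pa_root pa_edge c_pa _ accE cand_own cand_desc final_groupE) => w.
exact: pack_le.
Qed.

(** The messages read at the end were computed a round earlier; being stationary, they already carry
    the final names. *)
Lemma received_group u v : edge v u ->
  m_group (nth [::] (received T v) (index u (ports v))) = final_group u.
Proof.
move=> evu; rewrite nth_received ?mem_ports // -msg_stable.
by rewrite /m_group /= -surjective_pairing.
Qed.

Lemma final_output v : output grouping ports x T v =
  Some (node_output (x v) (received T v)).
Proof. by rewrite /output execE minnn /= ltnn. Qed.

Lemma completes_in_rounds : 0 < #|G| -> completes_in grouping ports x T.
Proof.
move=> G_gt0; split=> [v|r lt_r H]; first by rewrite final_output.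
have /card_gt0P[v _] := G_gt0; apply: (H v).
by rewrite /output execE (minn_idPl (ltnW lt_r)) /= lt_r.
Qed.

(** Entries are copied or are bounded by 2f + 2, by an identifier plus one, or, for bin numbers, by
    the number of ports. *)
Lemma message_bound M t v u :
  2 * f + 2 < 2 ^ M -> #|G| < 2 ^ M -> (forall v, (id v).+1 < 2 ^ M) ->
  all (fun n => n < 2 ^ M) (msg t v u).
Proof.
move=> fM GM idM; have gt0 : 0 < 2 ^ M by rewrite expn_gt0.
elim: t v u => // t IH v u; rewrite -[msg _ _ _]/(node_message _ (received t v) _).
have ibM m i : m \in received t v -> nth 0 m i < 2 ^ M.
  case/mapP=> w _ ->; case: (ltnP i (size (msg t w v))) => lt_i.
    by have /all_nthP := IH w v; apply.
  by rewrite nth_default.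
have ibM' j i : nth 0 (nth [::] (received t v) j) i < 2 ^ M.
  case: (ltnP j (size (received t v))) => lt_j; first by rewrite ibM ?mem_nth.
  by rewrite (nth_default _ lt_j) nth_nil.
have maxM (F : seq nat -> nat) :
    (forall m, m \in received t v -> F m < 2 ^ M) ->
    \max_(m <- received t v) F m < 2 ^ M.
  move=> FM; rewrite -(prednK gt0) ltnS; apply/bigmax_leqP_seq => m mi _.
  by rewrite -ltnS (prednK gt0) FM.
have szM : size (kids (received t v)) < 2 ^ M.
  rewrite !size_map; apply: leq_ltn_trans GM.
  by rewrite -(card_uniqP (ports_uniq v)) max_card.
have packM : (node_pack (x v) (kids (received t v))).2 < 2 ^ M.
  by apply: leq_ltn_trans szM; rewrite -(size_map (@fst _ _)) pack_bins.
have idM' : id v < 2 ^ M by apply: ltnW.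
have candM : candidate (x v) (kids (received t v)) < 2 ^ M.
  rewrite /candidate; case: ifP => _; first exact: idM.
  rewrite /kids big_map; apply: maxM => m mi.
  by case: ifP => //= _; apply: ibM.
have ogM : let o := node_group (x v) (kids (received t v))
    (parent_group (x v) (received t v)) in (o.1 < 2 ^ M) && (o.2 < 2 ^ M).
  rewrite /node_group /parent_group /=; case: ifP => _ /=; first by rewrite idM'.
  case: (v \in S) => /=; last by apply/andP; split; apply: ibM'.
  by rewrite gt0 andbT (leq_ltn_trans (leq_pred _)).
have chM : let o := child_group (x v) (kids (received t v))
    (parent_group (x v) (received t v)) (index u (ports v)) in
    (o.1 < 2 ^ M) && (o.2 < 2 ^ M).
  rewrite /child_group; case: ifP => [lt_b|_] //=.
  by rewrite idM' (ltn_trans lt_b).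
have closeM : closeness (x v) (received t v) < 2 ^ M.
  rewrite /closeness; case: ifP => [_|_]; first exact: fM.
  by apply: leq_ltn_trans (leq_pred _) (maxM _ _) => m mi; apply: ibM.
have pendM : pending (x v) (kids (received t v)) < 2 ^ M.
  rewrite /pending; case: ifP => [//|_]; apply: leq_ltn_trans fM.
  by have := pack_le f (unzip1 (kids (received t v))); rewrite /node_pack /=; lia.
have bitM (b : bool) : b < 2 ^ M by apply: leq_ltn_trans fM; case: b; lia.
move/andP: ogM => [og1 og2]; move/andP: chM => [ch1 ch2].
by rewrite /node_message /= closeM bitM pendM candM og1 og2 ch1 ch2.
Qed.

Lemma bandwidth_bound M :
  2 * f + 2 < 2 ^ M -> #|G| < 2 ^ M -> (forall v, (id v).+1 < 2 ^ M) ->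
  bandwidth_le grouping ports x (8 * M.*2.+1).
Proof.
move=> fM GM idM r v p m lt_p; rewrite /sent execE /=; case: ifP => // _ [<-].
apply: size_encode; rewrite -(index_uniq v lt_p (ports_uniq v)).
exact: (message_bound (minn r (rounds f)).+1).
Qed.

End Run.

(** * Shortcuts from stars *)

Section Stars.
Variables (G : sgraph) (Q : {set G}).

Definition star_vertex : {set G} :=
  [set u | (u \in Q) || [exists w in Q, edge u w]].

Lemma touchingP u v : touching Q u v -> (u \in star_vertex) && edge u v.
Proof.
rewrite /touching inE /= => /andP[euv /orP[->|vQ]]; rewrite euv //= andbT.
by apply/orP; right; apply/existsP; exists v; rewrite vQ.
Qed.

Definition star : subgraph G := Subgraph (@touching_sym G Q) touchingP.

Lemma induced_star_edge u v :
  sub_edge (sub_union (induced Q) star) u v = touching Q u v.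
Proof.
rewrite /= /union_edge /= /induced_edge /touching /=.
by case: (u \in Q); case: (v \in Q); case: edge.
Qed.

(** A vertex of the star outside [Q] has a neighbour in [Q], so all vertices are within 2f of
    [y]. *)
Lemma star_diameter (y : G) (f : nat) : 0 < f ->
  (forall u, u \in Q -> dist_le (touching Q) u y (2 * f - 1)) ->
  sub_diameter_le (sub_union (induced Q) star) (4 * f).
Proof.
move=> f_gt0 rad; set H := sub_union _ _.
have eq_path u p : path (sub_edge H) u p = path (touching Q) u p.
  by apply: eq_path => a b; apply: induced_star_edge.
have near u : u \in sub_vertex H -> dist_le (sub_edge H) u y (2 * f).
  move=> uH; suff [p [p1 p2 p3]] : dist_le (touching Q) u y (2 * f).
    by exists p; rewrite eq_path.
  move: uH; rewrite !inE orbA orbb => /orP[uQ|/existsP[w /andP[wQ euw]]].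
    by apply: dist_le_weaken (rad u uQ); lia.
  have tuw : touching Q u w by rewrite /touching /= euw wQ orbT.
  by apply: dist_le_weaken (dist_le_trans (dist_le_edge tuw) (rad w wQ)); lia.
move=> u v uH vH; have -> : 4 * f = 2 * f + 2 * f by lia.
exact: dist_le_trans (near u uH) (dist_le_sym (@sub_edge_sym _ H) (near v vH)).
Qed.

End Stars.

(** * The partition into classes of equal names, and its congestion *)

Section Classes.
Variables (G : sgraph) (nm : G -> nat).

Let names := undup [seq nm v | v <- enum G].
Let name (i : 'I_(size names)) := nth 0 names i.
Let Q i := [set v | nm v == name i].

Lemma name_inj : injective name.
Proof.
move=> i j /eqP; rewrite nth_uniq ?undup_uniq // => /eqP ij; exact: val_inj.
Qed.

Lemma name_surj v : exists i, name i = nm v.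
Proof.
have vn : nm v \in names by rewrite mem_undup map_f ?mem_enum.
have := vn; rewrite -index_mem => lt_i; exists (Ordinal lt_i).
exact: nth_index.
Qed.

Lemma name_used i : exists v, nm v = name i.
Proof.
have : name i \in names by apply: mem_nth.
by rewrite mem_undup => /mapP[v _ ->]; exists v.
Qed.

Lemma class_partition : is_partition Q.
Proof.
split=> [i|i j ij|].
- by have [v vi] := name_used i; apply/set0Pn; exists v; rewrite inE vi.
- apply/pred0P => v /=; rewrite !inE; apply: contraNF ij => /andP[/eqP-> /eqP].
  by move/name_inj->.
- apply/setP => v; rewrite inE; apply/bigcupP.
  by have [i vi] := name_surj v; exists i; rewrite // inE vi.
Qed.

Lemma star_congestion u v :
  #|[set i | sub_edge (sub_union (induced (Q i)) (star (Q i))) u v]| <= 2.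
Proof.
rewrite cardE -(size_map name).
apply: (@uniq_leq_size _ _ [:: nm u; nm v]).
  by rewrite (map_inj_uniq name_inj) enum_uniq.
move=> a /mapP[i]; rewrite mem_enum inE induced_star_edge => /andP[_] + ->.
by rewrite !inE ![_ == name i]eq_sym.
Qed.

End Classes.

Theorem theorem8 :
  exists (A : algorithm local_input local_output) (c1 c2 : nat),
  forall k : nat, exists b : nat,
  forall (f : nat) (G : sgraph) (id : G -> nat) (ports : G -> seq G)
         (S : {set G}),
    1 <= f -> f.+1 <= #|G| ->
    connected_graph G ->
    injective id -> (forall v, id v < #|G| ^ k) ->
    port_numbering ports ->
    ruling_set (2 * f + 2) (2 * f + 1) S ->
    let x := inputs f id S ports in
    bandwidth_le A ports x (b * up_log 2 #|G|) /\
    exists r : nat,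
      [/\ completes_in A ports x r, f <= c1 * r, r <= c2 * f
        & exists (K : nat) (Q : 'I_K -> {set G}) (H : 'I_K -> subgraph G)
                 (name : 'I_K -> nat),
          [/\ is_partition Q,
              forall i, f + 1 <= #|Q i| <= 3 * f + 1,
              shortcuts Q H 2 (4 * f)
            & outputs_encode ports (output A ports x r) Q H name]].
Proof.
(* The 6f + 10 rounds are at most 16f. A message has eight numbers below 2 ^ M, of 2M + 1 bits each,
   where M is k + 3 times the logarithm of the order. *)
exists grouping, 1, 16 => k; exists (8 * (2 * (k + 3) + 1)).
move=> f G id ports S f_gt0 cardG Gconn id_inj id_lt portsP S_ruling x.
split.
  set L := up_log 2 #|G|.
  have nL : #|G| <= 2 ^ L by have := up_logP #|G| (isT : 1 < 2).
  have L_gt0 : 0 < L by case: (L) nL => //; rewrite expn0; lia.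
  have mono i j : i <= j -> 2 ^ i <= 2 ^ j by move=> ij; rewrite leq_exp2l.
  have two i j : 2 ^ (i + j) = 2 ^ i * 2 ^ j by rewrite expnD.
  (* Two extra bits make room for 2f + 2, at most twice the order of the graph; below, one extra bit
     makes room for an identifier plus one. *)
  have L3 : 2 ^ (L + 2) <= 2 ^ ((k + 3) * L) by apply: mono; nia.
  have Lk : 2 ^ (k * L + 1) <= 2 ^ ((k + 3) * L) by apply: mono; nia.
  rewrite !two -[2 ^ 2]/4 expn1 in L3 Lk.
  have idL : #|G| ^ k <= 2 ^ (k * L).
    by rewrite mulnC expnM; case: (k) => [//|k']; rewrite leq_exp2r.
  suff: bandwidth_le grouping ports x (8 * ((k + 3) * L).*2.+1).
    move=> bw r v p m lt_p sm; apply: leq_trans (bw r v p m lt_p sm) _; nia.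
  apply: bandwidth_bound => // [||v]; try lia.
  by have := id_lt v; lia.
exists (rounds f); split; [| rewrite /rounds; lia | rewrite /rounds; lia |].
  by apply: completes_in_rounds; lia.
pose og := final_group f id ports S; pose nm v := pickle (og v).
have nmE u v : (nm u == nm v) = (og u == og v).
  by rewrite /nm (inj_eq (pcan_inj (@pickleK _))).
pose names := undup [seq nm v | v <- enum G].
pose name (i : 'I_(size names)) := nth 0 names i.
pose Q i := [set v | nm v == name i].
have QE i : exists v, Q i = [set u | og u == og v].
  have [v vi] : exists v, nm v = name i := name_used i; exists v; apply/setP => u.
  by rewrite !inE -vi nmE.
have diam i : sub_diameter_le (sub_union (induced (Q i)) (star (Q i))) (4 * f).
  have [v ->] := QE i.
  have [y rad] := final_group_radius f_gt0 portsP S_ruling cardG Gconn id_inj v.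
  by apply: (@star_diameter _ _ y) => // u; rewrite inE => /eqP; apply: rad.
exists (size names), Q, (fun i => star (Q i)), name; split.
- exact: class_partition.
- move=> i; have [v ->] := QE i.
  exact: (final_group_size f_gt0 portsP S_ruling cardG Gconn id_inj v).
- split=> [i u v uH vH||u v _] //; last exact: star_congestion.
  exact: dist_le_connect (diam i u v uH vH).
split; first exact: name_inj.
move=> v; exists (node_output (x v) (received f id ports S (rounds f) v)).
split; first exact: final_output.
  by move=> i; rewrite inE => /eqP.
move=> u evu a; rewrite /= received_group //.
(* The two names listed for an edge are those of its ends, that is, of the groups it touches. *)
rewrite -[a \in _]/(a \in [:: nm v; nm u]) !inE; split.
  have surj w : exists i, nm w = name i.
    by have [i wi] := name_surj nm w; exists i.
  case/orP=> /eqP ->; [have [i wi] := surj v | have [i wi] := surj u].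
    by exists i; rewrite //= /touching /= evu !inE wi eqxx.
  by exists i; rewrite //= /touching /= evu !inE wi eqxx orbT.
by case=> i -> /andP[_]; rewrite !inE => /orP[] /eqP ->; rewrite eqxx ?orbT.
Qed.
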